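(* Let $k,\alpha,\beta\in\mathbb{Z}^+$ and let $X$ be a real Banach space satisfying $\dim(X)\ge k+2$, $1\le\alpha\le\dim(X)-(k+1)$ and $k+1\le\beta\le\dim(X)-1$. Then the following statements are equivalent. (1) $X$ is $k$-WUR. (2) For every $\epsilon>0$ and $f_1,\dots,f_k\in S_{X^*}$, $\inf\{\delta^k_{X/M}(\epsilon,(f_j)_{j=1}^k): M\subseteq\bigcap_{j=1}^k\ker(f_j)\}>0$, the infimum being over subspaces $M$ of $X$. (3) For every $\epsilon>0$ and $f_1,\dots,f_k\in S_{X^*}$, $\inf\{\delta^k_{X/F}(\epsilon,(f_j)_{j=1}^k): F\subseteq\bigcap_{j=1}^k\ker(f_j),\ \dim(F)=\alpha\}>0$, the infimum being over subspaces $F$ of $X$. (4) For every $\epsilon>0$ and $f_1,\dots,f_k\in S_{X^*}$, $\inf\{\delta^k_{X/Y}(\epsilon,(f_j)_{j=1}^k): Y\subseteq\bigcap_{j=1}^k\ker(f_j),\ \operatorname{codim}(Y)=\beta\}>0$, the infimum being over subspaces $Y$ of $X$.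
   Context: $X$ may be infinite-dimensional (then the upper bounds on $\alpha,\beta$ are vacuous). All subspaces are assumed closed. $S_Z$ is the unit sphere of a Banach space $Z$ and $Z^*$ its dual. For $z_1,\dots,z_{k+1}\in Z$ and $f_1,\dots,f_k\in Z^*$, $D_k[(z_i)_{i=1}^{k+1};(f_j)_{j=1}^{k}]$ denotes the determinant of the $(k+1)\times(k+1)$ matrix whose first row consists of ones and whose $(j+1,i)$ entry is $f_j(z_i)$. For a Banach space $Z$, $\epsilon>0$ and $f_1,\dots,f_k\in S_{Z^*}$, $$\delta^k_Z(\epsilon,(f_j)_{j=1}^k):=\inf\Big(\{1\}\cup\Big\{1-\tfrac{1}{k+1}\Big\|\sum_{i=1}^{k+1}z_i\Big\| : z_1,\dots,z_{k+1}\in S_Z,\ |D_k[(z_i)_{i=1}^{k+1};(f_j)_{j=1}^{k}]|\ge\epsilon\Big\}\Big).$$ $Z$ is $k$-weakly uniformly rotund ($k$-WUR) if $\delta^k_Z(\epsilon,(f_j)_{j=1}^k)>0$ for every $\epsilon>0$ and $f_1,\dots,f_k\in S_{Z^*}$. For a subspace $M\subseteq X$, $(X/M)^*$ is identified isometrically with $M^\perp=\{f\in X^*:f|_M=0\}$; so if $M\subseteq\bigcap_j\ker(f_j)$, each $f_j\in S_{X^*}$ is regarded as an element of $S_{(X/M)^*}$ via $f_j(x+M)=f_j(x)$. *)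

(* Defs.v *)
From HB Require Import structures.
From mathcomp Require Import all_boot all_order all_algebra.
From mathcomp Require Import all_classical all_reals all_analysis.

Set Implicit Arguments.
Unset Strict Implicit.
Unset Printing Implicit Defensive.

Import Order.TTheory GRing.Theory Num.Theory.
Import numFieldNormedType.Exports.

Local Open Scope classical_set_scope.
Local Open Scope ring_scope.
Local Open Scope quotient_scope.

Section Dimension.
Variables (R : realType) (V : lmodType R).

Definition lin_indep n (v : 'I_n -> V) : Prop :=
  forall c : 'I_n -> R, \sum_i c i *: v i = 0 -> forall i, c i = 0.

Definition lin_span n (v : 'I_n -> V) : set V :=
  [set \sum_i c i *: v i | c in [set: 'I_n -> R]].

Definition has_dim (A : set V) (n : nat) : Prop :=
  exists v : 'I_n -> V, lin_indep v /\ A = lin_span v.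

(* [dim V >= n]; it holds for every [n] when [V] is infinite-dimensional. *)
Definition dim_ge (n : nat) : Prop := exists v : 'I_n -> V, lin_indep v.

End Dimension.

Section Dual.
Variables (R : realType) (Z : normedModType R).

Record dual := Dual {
  dual_fun :> {linear Z -> R^o} ;
  dual_continuous : continuous dual_fun }.

Definition dual_norm (f : dual) : R :=
  sup [set `|f z| | z in [set z : Z | `|z| <= 1]].

Definition dual_sphere : set dual := [set f | dual_norm f = 1].

Lemma dual_bounded (f : dual) : exists2 C : R, 0 < C &
  forall z, `|f z| <= C * `|z|.
Proof.
have /linear_boundedP := (linear_bounded_continuous (dual_fun f)).2
  (@dual_continuous f).
move=> H; near (pinfty_nbhs R) => C; exists C; near: C => //.
exact: nbhs_pinfty_gt.
Unshelve. all: by end_near. Qed.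

End Dual.

Record closedSubspace (R : realType) (X : normedModType R) := ClosedSubspace {
  csub_set :> set X ;
  csub_closed : closed csub_set ;
  csub0 : csub_set 0 ;
  csub_linear : forall (a : R) (x y : X),
    csub_set x -> csub_set y -> csub_set (a *: x + y) }.

Section QuotientSpace.
Variables (R : realType) (X : normedModType R) (M : closedSubspace X).

Definition csub_pred : {pred X} := fun x => `[< csub_set M x >].

Lemma csub_predP x : reflect (csub_set M x) (x \in csub_pred).
Proof. exact: asboolP. Qed.

Fact csub_submod_closed : submod_closed csub_pred.
Proof.
split; first exact/csub_predP/csub0.
by move=> a x y /csub_predP Mx /csub_predP My; exact/csub_predP/csub_linear.
Qed.

HB.instance Definition _ :=
  GRing.isSubmodClosed.Build R X csub_pred csub_submod_closed.

Definition quotient : Type := Quotient.quot csub_pred.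

HB.instance Definition _ := GRing.Zmodule.on quotient.

Definition to_quotient (x : X) : quotient := \pi_(Quotient.quot csub_pred) x.

Lemma to_quotientD : {morph to_quotient : x y / x + y}.
Proof. exact: (raddfD \pi_(Quotient.quot csub_pred)). Qed.

Lemma to_quotientN : {morph to_quotient : x / - x}.
Proof. exact: (raddfN \pi_(Quotient.quot csub_pred)). Qed.

Lemma to_quotient0 : to_quotient 0 = 0.
Proof. exact: (raddf0 \pi_(Quotient.quot csub_pred)). Qed.

Lemma to_quotientP x y : to_quotient x = to_quotient y <-> csub_set M (x - y).
Proof.
split.
  move/eqP; rewrite -[_ == _]/(x == y %[mod Quotient.quot csub_pred]).
  by rewrite -Quotient.idealrBE => /csub_predP.
by move=> /csub_predP; rewrite Quotient.idealrBE => /eqP.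
Qed.

Lemma to_quotient_surj (z : quotient) : exists x, to_quotient x = z.
Proof. by exists (repr (z : Quotient.quot csub_pred)); exact: reprK. Qed.

Definition quotient_repr (z : quotient) : X := repr (z : Quotient.quot csub_pred).

Lemma quotient_reprK : cancel quotient_repr to_quotient.
Proof. by move=> z; exact: reprK. Qed.

Definition quotient_scale (a : R) (z : quotient) : quotient :=
  to_quotient (a *: quotient_repr z).

Lemma quotient_scaleE a x :
  quotient_scale a (to_quotient x) = to_quotient (a *: x).
Proof.
apply/to_quotientP; rewrite -scalerBr -[_ *: _]addr0.
apply: csub_linear; last exact: csub0.
by apply/to_quotientP; rewrite quotient_reprK.
Qed.

Fact quotient_scalerA a b z :
  quotient_scale a (quotient_scale b z) = quotient_scale (a * b) z.
Proof. by rewrite -[z]quotient_reprK !quotient_scaleE scalerA. Qed.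

Fact quotient_scale1r : left_id 1 quotient_scale.
Proof. by move=> z; rewrite -[z]quotient_reprK quotient_scaleE scale1r. Qed.

Fact quotient_scalerDr : right_distributive quotient_scale +%R.
Proof.
move=> a y z; rewrite -[y]quotient_reprK -[z]quotient_reprK.
by rewrite -to_quotientD !quotient_scaleE scalerDr to_quotientD.
Qed.

Fact quotient_scalerDl z : {morph quotient_scale^~ z : a b / a + b}.
Proof.
move=> a b; rewrite -[z]quotient_reprK !quotient_scaleE.
by rewrite scalerDl to_quotientD.
Qed.

HB.instance Definition _ := GRing.Zmodule_isLmodule.Build R quotient
  quotient_scalerA quotient_scale1r quotient_scalerDr quotient_scalerDl.

Lemma to_quotientZ a x : to_quotient (a *: x) = a *: to_quotient x.
Proof. by rewrite -[RHS]/(quotient_scale _ _) quotient_scaleE. Qed.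

Definition quotient_norm (z : quotient) : R :=
  inf [set `|x| | x in [set x : X | to_quotient x = z]].

Let coset_norms (z : quotient) := [set `|x| | x in [set x : X | to_quotient x = z]].

Let has_inf_coset_norms z : has_inf (coset_norms z).
Proof.
split; first by have [x xz] := to_quotient_surj z; exists `|x|, x.
by exists 0 => _ [x _ <-].
Qed.

Lemma quotient_norm_le x : quotient_norm (to_quotient x) <= `|x|.
Proof. by apply: ge_inf; [case: (has_inf_coset_norms (to_quotient x))|exists x]. Qed.

Lemma quotient_norm_lt z e : quotient_norm z < e ->
  exists2 x, to_quotient x = z & `|x| < e.
Proof.
move=> /(inf_lt (has_inf_coset_norms z).1) [_ [x xz <-] xe].
by exists x.
Qed.

Lemma quotient_norm_ge0 z : 0 <= quotient_norm z.
Proof. by apply: lb_le_inf; [case: (has_inf_coset_norms z)|move=> _ [x _ <-]]. Qed.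

Fact quotient_ler_normD y z :
  quotient_norm (y + z) <= quotient_norm y + quotient_norm z.
Proof.
apply/ler_addgt0Pr => e e0; have e20 : 0 < e / 2 by rewrite divr_gt0.
have [x xy xe] : exists2 x, to_quotient x = y & `|x| < quotient_norm y + e / 2.
  by apply: quotient_norm_lt; rewrite ltrDl.
have [t tz te] : exists2 x, to_quotient x = z & `|x| < quotient_norm z + e / 2.
  by apply: quotient_norm_lt; rewrite ltrDl.
rewrite -xy -tz -to_quotientD (le_trans (quotient_norm_le _))//.
rewrite (le_trans (ler_normD _ _))// xy tz.
by rewrite [e]splitr addrACA lerD// ltW.
Qed.

Let quotient_normZ_le a z : quotient_norm (a *: z) <= `|a| * quotient_norm z.
Proof.
have [->|a0] := eqVneq a 0.
  rewrite scale0r normr0 mul0r -to_quotient0.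
  by rewrite (le_trans (quotient_norm_le _))// normr0.
rewrite -ler_pdivrMl ?normr_gt0//; apply: lb_le_inf.
  by case: (has_inf_coset_norms z).
move=> _ [x <- <-]; rewrite ler_pdivrMl ?normr_gt0// -normrZ -to_quotientZ.
exact: quotient_norm_le.
Qed.

Fact quotient_normrZ a z : quotient_norm (a *: z) = `|a| * quotient_norm z.
Proof.
apply/eqP; rewrite eq_le quotient_normZ_le/=.
have [->|a0] := eqVneq a 0; first by rewrite normr0 mul0r quotient_norm_ge0.
rewrite -ler_pdivlMl ?normr_gt0// -normfV.
by rewrite -{1}[z](scalerK a0).
Qed.

Fact quotient_normr0_eq0 z : quotient_norm z = 0 -> z = 0.
Proof.
have [x <-] := to_quotient_surj z => x0.
rewrite -to_quotient0; apply/to_quotientP; rewrite subr0.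
apply: (@csub_closed _ _ M) => B /nbhs_ballP[e /= e0 eB].
have [|y yx ye] := @quotient_norm_lt (to_quotient x) e; first by rewrite x0.
exists (x - y); split; first exact/to_quotientP.
by apply: eB; rewrite -ball_normE /= opprB addrC subrK.
Qed.

HB.instance Definition _ := Lmodule_isNormed.Build R quotient
  quotient_ler_normD quotient_normrZ quotient_normr0_eq0.

Lemma quotient_normE (z : quotient) :
  `|z| = inf [set `|x| | x in [set x : X | to_quotient x = z]].
Proof. by []. Qed.

End QuotientSpace.

Section QuotientDual.
Variables (R : realType) (X : normedModType R) (M : closedSubspace X).
Variables (f : dual X) (fM : (M : set X) `<=` [set x | f x = 0]).

(* Since [f] vanishes on [M], this is the map [x + M |-> f x]; see
   [quotient_dualE]. *)
Definition quotient_dual_fun (z : quotient M) : R^o := f (quotient_repr z).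

Lemma quotient_dual_funE x : quotient_dual_fun (to_quotient M x) = f x.
Proof.
apply/eqP; rewrite -subr_eq0 -linearB; apply/eqP/fM/to_quotientP.
by rewrite quotient_reprK.
Qed.

Fact quotient_dual_linear : linear quotient_dual_fun.
Proof.
move=> a y z; rewrite -[y]quotient_reprK -[z]quotient_reprK.
by rewrite -to_quotientZ -to_quotientD !quotient_dual_funE linearP.
Qed.

HB.instance Definition _ := GRing.isLinear.Build R (quotient M) R^o _
  quotient_dual_fun quotient_dual_linear.

Fact quotient_dual_continuous :
  continuous (quotient_dual_fun : {linear quotient M -> R^o}).
Proof.
have [C C0 fC] := dual_bounded f.
apply/linear_bounded_continuous/linear_boundedP.
near=> r => z; apply: (@le_trans _ _ (C * `|z|)); last first.
  by apply: ler_wpM2r => //; near: r; exact: nbhs_pinfty_ge.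
rewrite -ler_pdivrMl//; apply: lb_le_inf.
  by have [x xz] := to_quotient_surj z; exists `|x|, x.
by move=> _ [x <- <-]; rewrite ler_pdivrMl//= quotient_dual_funE.
Unshelve. all: by end_near. Qed.

Definition quotient_dual : dual (quotient M) := Dual quotient_dual_continuous.

Lemma quotient_dualE x : quotient_dual (to_quotient M x) = f x.
Proof. exact: quotient_dual_funE. Qed.

Lemma quotient_dual_norm : dual_norm quotient_dual = dual_norm f.
Proof.
have [C C0 fC] := dual_bounded f.
have hs : has_sup [set `|f x| | x in [set x : X | `|x| <= 1]].
  split; first by exists `|f 0|, 0 => //=; rewrite normr0.
  by exists C => _ [x /= x1 <-]; rewrite (le_trans (fC x))// ler_piMr// ltW.
have [D D0 gD] := dual_bounded quotient_dual.
have hs' : has_sup [set `|quotient_dual x| | x in [set x : quotient M | `|x| <= 1]].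
  split; first by exists `|quotient_dual 0|, 0 => //=; rewrite normr0.
  by exists D => _ [x /= x1 <-]; rewrite (le_trans (gD x))// ler_piMr// ltW.
have fle x : `|f x| <= dual_norm f * `|x|.
  have [->|x0] := eqVneq x 0; first by rewrite linear0 !normr0 mulr0.
  rewrite -ler_pdivrMr ?normr_gt0//; apply: ub_le_sup; first exact: hs.2.
  exists (`|x|^-1 *: x) => /=.
    by rewrite normrZ normfV normr_id mulVf// normr_eq0.
  by rewrite linearZ/= normrM normfV normr_id mulrC.
apply/eqP; rewrite eq_le; apply/andP; split.
  apply: ge_sup; first exact: hs'.1.
  move=> _ [z /= z1 <-]; apply/ler_addgt0Pr => e e0.
  have f0 : 0 <= dual_norm f.
    by apply: ub_le_sup; [exact: hs.2|exists 0; rewrite /= ?linear0 ?normr0].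
  have d0 : 0 < e / (dual_norm f + 1) by rewrite divr_gt0// ltr_wpDl.
  have [|x xz xe] := @quotient_norm_lt _ _ M z (1 + e / (dual_norm f + 1)).
    by rewrite (le_lt_trans z1)// ltrDl.
  rewrite -xz quotient_dual_funE (le_trans (fle x))//.
  rewrite (le_trans (ler_wpM2l f0 (ltW xe)))// mulrDr mulr1 lerD2l.
  have f1 : 0 < dual_norm f + 1 by rewrite ltr_wpDl.
  by rewrite mulrCA ler_piMr ?(ltW e0)// ler_pdivrMr// mul1r lerDl.
apply: ge_sup; first exact: hs.1.
move=> _ [x /= x1 <-]; apply: ub_le_sup; first exact: hs'.2.
exists (to_quotient M x) => /=; last by rewrite quotient_dual_funE.
exact: le_trans (quotient_norm_le _ _) x1.
Qed.

End QuotientDual.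

Section WeakRotundity.
Variables (R : realType) (k : nat).

Definition Dk (Z : normedModType R) (z : 'I_k.+1 -> Z) (f : 'I_k -> dual Z) : R :=
  \det (col_mx (const_mx 1 : 'M[R]_(1, k.+1))
               (\matrix_(j < k, i < k.+1) f j (z i)) : 'M[R]_k.+1).

Definition delta (Z : normedModType R) (eps : R) (f : 'I_k -> dual Z) : R :=
  inf ([set 1] `|`
       [set 1 - k.+1%:R^-1 * `|\sum_(i < k.+1) z i| | z in
          [set z : 'I_k.+1 -> Z |
            (forall i, `|z i| = 1) /\ eps <= `|Dk z f|]]).

Definition kWUR (Z : normedModType R) : Prop :=
  forall (eps : R) (f : 'I_k -> dual Z), 0 < eps ->
    (forall j, dual_sphere (f j)) -> 0 < delta eps f.

Definition inf_delta_quotient (X : normedModType R)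
    (P : closedSubspace X -> Prop) (eps : R) (f : 'I_k -> dual X) : R :=
  inf [set d | exists (M : closedSubspace X)
                      (fM : forall j, (M : set X) `<=` [set x | f j x = 0]),
                 P M /\ d = delta eps (fun j => quotient_dual (fM j))].

End WeakRotundity.

(* Main.v *)
(** If [X] is [k]-WUR, lifting near-unit representatives of unit vectors of
[X/M] and normalising them bounds [delta] of every quotient below, uniformly in
[M].  Conversely, given unit vectors [z_i] in [X], a Hahn-Banach functional [g]
norming their sum, and [M] inside the kernels of [g] and of the [f_j], the sum
keeps its norm in [X/M]; when that norm is close to [k+1], the images of the
[z_i] have norm close to 1, so they can be normalised at little cost to [D_k].
Subspaces [M] of prescribed dimension or codimension inside [k+1] kernels come
from extending biorthogonal systems.  Hahn-Banach itself follows from Zorn's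
lemma: a minimal sublinear functional is linear. *)

From HB Require Import structures.
Require Import Defs.
From mathcomp Require Import all_boot all_order all_algebra.
From mathcomp Require Import all_classical all_reals all_analysis.
From mathcomp Require Import perm ring lra.

Set Implicit Arguments.
Unset Strict Implicit.
Unset Printing Implicit Defensive.

Import Order.TTheory GRing.Theory Num.Theory.
Import numFieldNormedType.Exports.
Local Open Scope classical_set_scope.
Local Open Scope ring_scope.

(** * Sublinear functionals and Zorn's lemma *)

Definition sublinear (R : realType) (X : lmodType R) (p : X -> R) : Prop :=
  (forall x y, p (x + y) <= p x + p y) /\
  (forall a x, 0 < a -> p (a *: x) <= a * p x).

Section Sublinear.
Variables (R : realType) (X : lmodType R).
Implicit Types (p q : X -> R) (x y : X).

Lemma sublinear0 p : sublinear p -> p 0 = 0.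
Proof.
move=> [pD pZ]; apply/eqP; rewrite eq_le; apply/andP; split.
  have := pZ 2^-1 0 (ltac:(by rewrite invr_gt0)); rewrite scaler0; lra.
by have := pD 0 0; rewrite addr0; lra.
Qed.

Lemma sublinearZ p a x : sublinear p -> 0 <= a -> p (a *: x) = a * p x.
Proof.
move=> sp; rewrite le_eqVlt => /predU1P[<-|a0].
  by rewrite scale0r mul0r sublinear0.
apply/eqP; rewrite eq_le sp.2//= -ler_pdivlMl//.
rewrite -{1}(scalerK (lt0r_neq0 a0) x).
by rewrite sp.2// invr_gt0.
Qed.

Lemma sublinearN_ge p x : sublinear p -> - p (- x) <= p x.
Proof. by move=> sp; have := sp.1 x (- x); rewrite subrr sublinear0//; lra. Qed.

(** It serves both [linearize] and lower bounds of chains in Zorn's lemma. The two combine members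
    differently, hence the mere existence of a dominating [r]. *)
Lemma sublinear_inf (G : set (X -> R)) : G !=set0 ->
  (forall x, has_lbound [set p x | p in G]) ->
  (forall p q x y, G p -> G q -> exists2 r, G r & r (x + y) <= p x + q y) ->
  (forall p a x, G p -> 0 < a -> exists2 r, G r & r (a *: x) <= a * p x) ->
  sublinear (fun x => inf [set p x | p in G]).
Proof.
move=> [p0 Gp0] lbG GD GZ.
have infG x : [set p x | p in G] !=set0 by exists (p0 x), p0.
have le_inf x r : G r -> inf [set p x | p in G] <= r x.
  by move=> Gr; apply: ge_inf => //; exists r.
split=> [x y|a x a0].
  rewrite -lerBlDr; apply: lb_le_inf => // _ [p Gp <-].
  rewrite lerBlDr -lerBlDl; apply: lb_le_inf => // _ [q Gq <-].
  have [r Gr rpq] := GD _ _ x y Gp Gq.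
  by rewrite lerBlDl (le_trans (le_inf _ _ Gr)).
rewrite -ler_pdivrMl//; apply: lb_le_inf => // _ [p Gp <-].
have [r Gr rp] := GZ _ _ x Gp a0.
by rewrite ler_pdivrMl// (le_trans (le_inf _ _ Gr)).
Qed.

(* The largest sublinear functional [q <= p] with [q (- y) = - p y]. *)
Definition linearize p y x : R :=
  inf [set p (x + t *: y) - t * p y | t in [set t : R | 0 <= t]].

(** The bound [- p (- x)] does not depend on [t]: split [t *: y] into [x + t *: y] and [- x]. *)
Lemma linearize_lbound p y x : sublinear p ->
  has_lbound [set p (x + t *: y) - t * p y | t in [set t : R | 0 <= t]].
Proof.
move=> sp; exists (- p (- x)) => _ [t /= t0 <-].
have := sp.1 (x + t *: y) (- x); rewrite addrAC subrr add0r sublinearZ//; lra.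
Qed.

Lemma linearize_le p y x t : sublinear p -> 0 <= t ->
  linearize p y x <= p (x + t *: y) - t * p y.
Proof. by move=> sp t0; apply: ge_inf; [exact: linearize_lbound|exists t]. Qed.

(** Parameters [s] and [t] combine to [s + t], and scaling by [a] turns [t] into [a * t]. *)
Lemma sublinear_linearize p y : sublinear p -> sublinear (linearize p y).
Proof.
move=> sp; pose q t x := p (x + t *: y) - t * p y.
have -> : linearize p y = fun x => inf [set r x | r in q @` [set t | 0 <= t]].
  by apply/funext => x; rewrite image_comp.
apply: sublinear_inf.
- by exists (q 0), 0 => /=.
- by move=> x; rewrite image_comp; exact: linearize_lbound.
- move=> _ _ x z [s /= s0 <-] [t /= t0 <-].
  exists (q (s + t)); first by exists (s + t) => //=; exact: addr_ge0.
  rewrite /q scalerDl addrACA.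
  by have := sp.1 (x + s *: y) (z + t *: y); lra.
move=> _ a x [t /= t0 <-] a0; exists (q (a * t)).
  by exists (a * t) => //=; rewrite mulr_ge0// ltW.
rewrite /q -scalerA -scalerDr sublinearZ ?(ltW a0)//; lra.
Qed.

Lemma linearize_le_self p y x : sublinear p -> linearize p y x <= p x.
Proof.
by move=> sp; have := linearize_le y x sp (lexx 0); rewrite scale0r addr0 mul0r subr0.
Qed.

Lemma linearizeN p y : sublinear p -> linearize p y (- y) <= - p y.
Proof.
move=> sp; have := linearize_le y (- y) sp ler01.
by rewrite scale1r addNr sublinear0// mul1r sub0r.
Qed.

Lemma minimal_sublinear p0 : sublinear p0 ->
  exists p, [/\ sublinear p, (forall x, p x <= p0 x) &
    forall q, sublinear q -> (forall x, q x <= p x) -> q = p].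
Proof.
move=> sp0.
pose T := {p : X -> R | sublinear p /\ forall x, p x <= p0 x}.
(* The order is reversed, so that maximal elements for Zorn are pointwise minimal functionals. *)
pose below (p q : T) := `[< forall x, sval q x <= sval p x >].
have [] := @Zorn T below; last 1 first.
- move=> [p [sp pp0]] pmin; exists p; split=> // q sq qp.
  have qT : sublinear q /\ forall x, q x <= p0 x.
    by split=> // x; exact: le_trans (qp x) (pp0 x).
  by have /(congr1 sval) := pmin (exist _ q qT) (asboolT qp).
- by move=> p; apply/asboolP => x.
- move=> q p r /asboolP pq /asboolP qr; apply/asboolP => x.
  exact: le_trans (qr x) (pq x).
- move=> [p pP] [q qP] /asboolP/= pq /asboolP/= qp; apply/eq_exist/funext => x.
  by apply/eqP; rewrite eq_le (qp x) (pq x).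
- move=> A Atot; have [[t At]|A0] := pselect (A !=set0); last first.
    (* An empty chain is bounded by [p0] itself; otherwise the pointwise infimum is taken. *)
    exists (exist _ p0 (conj sp0 (fun x => lexx (p0 x)))) => s As.
    by case: A0; exists s.
  pose G := [set sval p | p in A].
  (* Each [q] in the chain satisfies [- p0 (- x) <= - q (- x) <= q x]. *)
  have lbG x : has_lbound [set p x | p in G].
    exists (- p0 (- x)) => _ [_ [[q [sq qp0]] _ <-] <-] /=.
    by rewrite (le_trans _ (sublinearN_ge x sq))// lerN2.
  have sG : sublinear (fun x => inf [set p x | p in G]).
    apply: sublinear_inf => //.
    - by exists (sval t), t.
    - move=> _ _ x y [p Ap <-] [q Aq <-]; have [sp _] := svalP p.
      have [sq _] := svalP q.
      have [/asboolP qp|/asboolP pq] := Atot _ _ Ap Aq.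
        exists (sval q); first by exists q.
        by rewrite (le_trans (sq.1 x y))// lerD2r qp.
      exists (sval p); first by exists p.
      by rewrite (le_trans (sp.1 x y))// lerD2l pq.
    - move=> _ a x [p Ap <-] a0; exists (sval p); first by exists p.
      by apply: (svalP p).1.2.
  have Gle s x : A s -> inf [set p x | p in G] <= sval s x.
    by move=> As; apply: ge_inf => //; exists (sval s) => //; exists s.
  have Gp0 x : inf [set p x | p in G] <= p0 x.
    exact: le_trans (Gle _ x At) ((svalP t).2 x).
  exists (exist (fun p => sublinear p /\ forall x, p x <= p0 x) _ (conj sG Gp0)) => s As.
  by apply/asboolP => x; exact: Gle.
Qed.

(** Minimality forces [linearize p x = p] for every [x], so [p] is odd, and an odd subadditive
    functional is additive. *)
Lemma minimal_sublinear_linear p : sublinear p ->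
  (forall q, sublinear q -> (forall x, q x <= p x) -> q = p) ->
  linear (p : X -> R^o).
Proof.
move=> sp pmin.
have pN x : p (- x) = - p x.
  apply/eqP; rewrite eq_le; apply/andP; split; last first.
    by have := sublinearN_ge (- x) sp; rewrite opprK.
  rewrite -{1}(pmin _ (sublinear_linearize x sp)); first exact: linearizeN.
  by move=> y; exact: linearize_le_self.
have pD x y : p (x + y) = p x + p y.
  apply/eqP; rewrite eq_le sp.1/= -lerBrDr -pN.
  by have := sp.1 (x + y) (- y); rewrite addrK.
move=> a x y; rewrite pD; congr (_ + _).
have [a0|a0] := leP 0 a; first exact: sublinearZ.
by rewrite -[a]opprK scaleNr pN sublinearZ// ?scaleNr ?mulNr// oppr_ge0 ltW.
Qed.

End Sublinear.

(** * Norming functionals *)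

Section NormedDual.
Variables (R : realType) (X : normedModType R).
Implicit Types (f g h : dual X) (x : X).

Lemma dual_of_bounded (u : X -> R^o) (C : R) :
  linear u -> (forall x, `|u x| <= C * `|x|) -> exists f, forall x, f x = u x.
Proof.
move=> lu uC.
pose L : {linear X -> R^o} := HB.pack u (GRing.isLinear.Build R X R^o *:%R u lu).
have cL : continuous L.
  apply/linear_bounded_continuous/linear_boundedP.
  near=> r => x; apply: (le_trans (uC x)).
  by apply: ler_wpM2r => //; near: r; exact: nbhs_pinfty_ge.
by exists (Dual cL).
Unshelve. all: by end_near. Qed.

(** A minimal functional [p] below the norm linearized at [x0] satisfies
    [- p x0 <= p (- x0) <= - |x0|]. The case [x0 = 0] is allowed and still supplies some
    functional. *)
Lemma norming_dual x0 : exists g, (forall x, `|g x| <= `|x|) /\ g x0 = `|x0|.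
Proof.
have sn : sublinear (fun x : X => `|x|).
  split; first exact: ler_normD.
  by move=> a x a0; rewrite normrZ gtr0_norm.
have [p [sp pn pmin]] := minimal_sublinear (sublinear_linearize x0 sn).
have lp := minimal_sublinear_linear sp pmin.
have ple x : p x <= `|x| by exact: le_trans (pn x) (linearize_le_self x0 x sn).
have pnorm x : `|p x| <= `|x|.
  rewrite ler_norml ple andbT lerNl -(normrN x).
  by rewrite (le_trans _ (ple (- x)))// lerNl sublinearN_ge.
have [|g gp] := @dual_of_bounded p 1 lp; first by move=> x; rewrite mul1r.
exists g; split=> [x|]; first by rewrite gp.
rewrite gp; apply/eqP; rewrite eq_le ple/= -lerN2.
apply: le_trans (linearizeN x0 sn); apply: le_trans (pn _).
by rewrite lerNl sublinearN_ge.
Qed.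

Lemma dualZ f a x : f (a *: x) = a * f x :> R.
Proof. exact: linearZ. Qed.

Lemma dual_sphere_le f x : dual_sphere f -> `|f x| <= `|x|.
Proof.
rewrite /dual_sphere/= => f1; have [C C0 fC] := dual_bounded f.
have [->|x0] := eqVneq x 0; first by rewrite linear0 !normr0.
rewrite -[leRHS]mul1r -ler_pdivrMr ?normr_gt0// -f1; apply: ub_le_sup.
  by exists C => _ [y /= y1 <-]; rewrite (le_trans (fC y))// ler_piMr// ltW.
exists (`|x|^-1 *: x) => /=.
  by rewrite normrZ normfV normr_id mulVf// normr_eq0.
by rewrite dualZ normrM normfV normr_id mulrC.
Qed.

End NormedDual.

(** * Biorthogonal systems and subspaces inside given kernels *)

Lemma ord_fun_extend (T : nmodType) m (c : 'I_m -> T) :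
  exists c' : nat -> T, forall i : 'I_m, c i = c' i.
Proof.
by exists (fun j => if insub j is Some i then c i else 0) => i; rewrite valK.
Qed.

Section Biorthogonal.
Variables (R : realType) (X : normedModType R).
Implicit Types (m n : nat) (e : nat -> X) (g h : nat -> dual X).

(** Both families are indexed by [nat], with only the first [m] entries constrained, so that a
    system grows without a change of type. *)
Definition biorthogonal m e g : Prop :=
  forall i j, (i < m)%N -> (j < m)%N -> g i (e j) = (i == j)%:R :> R.

Lemma biorthogonal_coef m e g (c : nat -> R) i : biorthogonal m e g ->
  (i < m)%N -> g i (\sum_(j < m) c j *: e j) = c i.
Proof.
move=> eg im; rewrite linear_sum (bigD1 (Ordinal im))//= dualZ eg// eqxx.
rewrite big1 ?addr0 => [|j ji]; first by rewrite mulr1.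
by move: ji; rewrite -val_eqE/= eq_sym dualZ eg// => /negPf->; rewrite mulr0.
Qed.

Lemma dual_sub_sum m (f : dual X) (a : nat -> R) g :
  exists f' : dual X, forall x, f' x = f x - \sum_(i < m) a i * g i x.
Proof.
elim: m => [|m [f' f'E]].
  by exists f => x; rewrite big_ord0 subr0.
have [C C0 fC] := dual_bounded f'; have [D D0 gD] := dual_bounded (g m).
pose u x : R^o := f' x - a m * g m x.
have lu : linear u.
  move=> b x y; rewrite /u !linearP/= /GRing.scale/=; ring.
have [|f'' f''E] := @dual_of_bounded _ _ u (C + `|a m| * D) lu.
  move=> x; rewrite (le_trans (ler_normB _ _))// mulrDl lerD//.
  by rewrite normrM -mulrA ler_wpM2l.
by exists f'' => x; rewrite f''E /u f'E big_ord_recr/= opprD addrA.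
Qed.

(** Gram-Schmidt on the dual side: subtracting [h (e i) * g i] from [h] makes it vanish on every
    [e i] without changing its value at [v]. The last clause holds because [h] is a combination of
    the new functionals. *)
Lemma biorthogonalS m e g (h : dual X) v : biorthogonal m e g ->
  (forall i, (i < m)%N -> g i v = 0) -> h v != 0 ->
  exists e' g', [/\ biorthogonal m.+1 e' g',
    forall i, (i < m)%N -> e' i = e i /\ g' i = g i &
    forall x, (forall i, (i < m.+1)%N -> g' i x = 0) -> h x = 0].
Proof.
move=> eg gv hv; have [f fE] := dual_sub_sum m h (fun i => h (e i)) g.
have fe i : (i < m)%N -> f (e i) = 0.
  move=> im; rewrite fE (bigD1 (Ordinal im))//= eg// eqxx mulr1 big1 ?addr0 ?subrr//.
  by move=> j; rewrite -val_eqE/= eg// => /negPf->; rewrite mulr0.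
have fv : f v = h v.
  by rewrite fE big1 ?subr0// => i _; rewrite gv ?mulr0.
exists (fun i => if (i < m)%N then e i else (h v)^-1 *: v).
exists (fun i => if (i < m)%N then g i else f); split.
- move=> i j; rewrite !ltnS (leq_eqVlt i) (leq_eqVlt j).
  move=> /predU1P[->|im] /predU1P[->|jm]; rewrite ?ltnn ?im ?jm ?eqxx.
  + by rewrite dualZ fv mulVf.
  + by rewrite fe// gtn_eqF.
  + by rewrite dualZ gv// mulr0 ltn_eqF.
  + exact: eg.
- by move=> i ->.
- move=> x gx; have := gx m (ltnSn m); rewrite ltnn fE big1 ?subr0// => i _.
  by have := gx i (ltnW (ltn_ord i)); rewrite ltn_ord => ->; rewrite mulr0.
Qed.

(** Otherwise the coordinates of [n] independent vectors form an [n] by [m] matrix, whose nonzero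
    left kernel gives a linear dependence. *)
Lemma not_spanned m n e : dim_ge X n -> (m < n)%N ->
  exists x, forall c : 'I_m -> R, x <> \sum_i c i *: e i.
Proof.
move=> [v vfree] mn; apply: contrapT => spanned.
have /choice[c vc] : forall i, exists c : 'I_m -> R, v i = \sum_j c j *: e j.
  move=> i; apply: contrapT => nc; apply: spanned; exists (v i) => c ci.
  by apply: nc; exists c.
pose A : 'M[R]_(n, m) := \matrix_(i, j) c i j.
have : kermx A != 0.
  by rewrite -mxrank_eq0 mxrank_ker subn_eq0 -ltnNge (leq_ltn_trans (rank_leq_col A)).
move=> /rowV0Pn[w /sub_kermxP wA /eqP]; apply; apply/rowP => i; rewrite mxE.
apply: (vfree (fun i => w 0 i)).
under eq_bigr do rewrite vc scaler_sumr.
rewrite exchange_big big1// => j _.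
under eq_bigr do rewrite scalerA.
rewrite -scaler_suml; move/rowP : wA => /(_ j); rewrite !mxE => wA.
by rewrite (eq_bigr (fun i => w 0 i * A i j)) ?wA ?scale0r// => l _; rewrite mxE.
Qed.

Lemma biorthogonal_extend p m n e g : biorthogonal m e g -> dim_ge X n ->
  (m + p <= n)%N -> exists e' g', biorthogonal (m + p) e' g' /\
    forall i, (i < m)%N -> e' i = e i /\ g' i = g i.
Proof.
move=> eg Xn; elim: p => [|p IH] mpn; first by exists e, g; rewrite addn0.
rewrite addnS in mpn.
have [e1 [g1 [eg1 E1]]] := IH (ltnW mpn).
have [x xe] := not_spanned e1 Xn mpn.
(* Removing the projection of [x] puts [v] in the kernel of every [g1 i], and [v] is nonzero as [x]
   lies outside the span; a functional norming [v] then extends the system. *)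
pose v := x - \sum_(i < m + p) g1 i x *: e1 i.
have v0 : v != 0.
  by apply/eqP => /eqP; rewrite subr_eq0 => /eqP; exact: xe.
have gv i : (i < m + p)%N -> g1 i v = 0.
  by move=> imp; rewrite linearB/= (biorthogonal_coef (fun j => g1 j x) eg1)// subrr.
have [f [_ fv]] := norming_dual v.
have [|e2 [g2 [eg2 E2 _]]] := @biorthogonalS _ _ _ f v eg1 gv.
  by rewrite fv normr_eq0.
exists e2, g2; rewrite addnS; split=> // i im.
have [-> ->] := E2 i (leq_trans im (leq_addr p m)); exact: E1.
Qed.

(** Induction on [n]: either [h n] is nonzero somewhere on the current common kernel and extends the
    system, or it already vanishes there. Dependent functionals make [m] smaller than [n]. *)
Lemma biorthogonal_annihilate n h : exists m e g,
  [/\ (m <= n)%N, biorthogonal m e g &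
      forall x, (forall i, (i < m)%N -> g i x = 0) ->
      forall j, (j < n)%N -> h j x = 0].
Proof.
elim: n => [|n [m [e [g [mn eg gh]]]]].
  by exists 0, (fun=> 0), h; split.
have [[v gv /eqP hv]|noV] :=
    pselect (exists2 v, forall i, (i < m)%N -> g i v = 0 & h n v <> 0).
  have [e' [g' [eg' E' g'h]]] := biorthogonalS eg gv hv.
  exists m.+1, e', g'; split=> // x g'x j.
  rewrite ltnS leq_eqVlt => /predU1P[->|]; first exact: g'h.
  apply: gh => i im; have [_ <-] := E' i im; exact/g'x/ltnW.
exists m, e, g; split=> //; first exact: ltnW.
move=> x gx j; rewrite ltnS leq_eqVlt => /predU1P[->|]; last exact: gh.
by apply: contrapT => hx; apply: noV; exists x.
Qed.

Lemma common_kernel_closed m g :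
  closed [set x | forall i, (i < m)%N -> g i x = 0].
Proof.
rewrite [X in closed X](_ : _ = \bigcap_(i in `I_m) (g i @^-1` [set 0])); last first.
  by apply/seteqP; split => x; apply.
apply: closed_bigI => i _; apply: preimage_closed.
  by move=> x _; exact: dual_continuous.
exact: closed_eq.
Qed.

Definition common_kernel m g : closedSubspace X.
Proof.
exists [set x | forall i, (i < m)%N -> g i x = 0].
- exact: common_kernel_closed.
- by move=> i _; rewrite linear0.
- by move=> a x y gx gy i im; rewrite linearP/= gx// gy// scaler0 addr0.
Defined.

(** The classes of the [e i] form a basis, with coordinates [g i x]. *)
Lemma codim_common_kernel m e g : biorthogonal m e g ->
  has_dim [set: quotient (common_kernel m g)] m.
Proof.
move=> eg; set Y := common_kernel m g.
have sumE (c : nat -> R) :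
    \sum_(i < m) c i *: to_quotient Y (e i) = to_quotient Y (\sum_(i < m) c i *: e i).
  rewrite (big_morph _ (@to_quotientD _ _ Y) (@to_quotient0 _ _ Y)).
  by apply: eq_bigr => i _; rewrite to_quotientZ.
exists (fun i : 'I_m => to_quotient Y (e i)); split.
  move=> c; have [c' c'E] := ord_fun_extend c; under eq_bigr do rewrite c'E.
  rewrite sumE -(to_quotient0 Y) => /to_quotientP; rewrite subr0 => gc i.
  by rewrite c'E -(biorthogonal_coef c' eg (ltn_ord i)) gc.
apply/seteqP; split=> // z _; have [x <-] := to_quotient_surj z.
exists (fun i : 'I_m => g i x) => //.
rewrite (sumE (fun i => g i x)); apply/to_quotientP => i im.
by rewrite linearB/= (biorthogonal_coef (fun j => g j x) eg)// subrr.
Qed.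

(* For a biorthogonal system the span is the fixed-point set of the continuous
   projection [x |-> \sum_i g_i(x) e_i], hence closed. *)
Lemma biorthogonal_span_closed m e g :
  closed [set x | x = \sum_(i < m) g i x *: e i].
Proof.
pose P x := x - \sum_(i < m) g i x *: e i.
rewrite [X in closed X](_ : _ = P @^-1` [set 0]); last first.
  apply/seteqP; split=> x /=; last exact: subr0_eq.
  by move=> /eqP; rewrite -subr_eq0 => /eqP.
apply: preimage_closed; last first.
  apply: accessible_finite_set_closed.1 (finite_set1 _).
  exact/hausdorff_accessible/norm_hausdorff.
move=> x _; apply: cvgB; first exact: cvg_id.
apply: cvg_big => [|i _]; first exact: add_continuous.
by apply: cvgZr_tmp; exact: (@dual_continuous _ _ (g i) x).
Qed.

Definition biorthogonal_span m e g : closedSubspace X.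
Proof.
exists [set x | x = \sum_(i < m) g i x *: e i].
- exact: biorthogonal_span_closed.
- by rewrite /= big1// => i _; rewrite linear0 scale0r.
- move=> a x y /= {1}-> {1}->; rewrite scaler_sumr -big_split.
  by apply: eq_bigr => i _; rewrite linearP scalerDl scalerA.
Defined.

Lemma dim_biorthogonal_span m e g : biorthogonal m e g ->
  has_dim (biorthogonal_span m e g : set X) m.
Proof.
move=> eg; exists (fun i : 'I_m => e i); split.
  move=> c; have [c' c'E] := ord_fun_extend c; under eq_bigr do rewrite c'E.
  by move=> c0 i; rewrite c'E -(biorthogonal_coef c' eg (ltn_ord i)) c0 linear0.
apply/seteqP; split=> [x /= ->|_ [c _ <-]] /=.
  by exists (fun i : 'I_m => g i x).
have [c' c'E] := ord_fun_extend c; under eq_bigr do rewrite c'E.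
by under [RHS]eq_bigr do rewrite (biorthogonal_coef c' eg (ltn_ord _)).
Qed.

(** The system annihilating the [h j] is padded to exactly [b] functionals, whose common kernel is
    taken. *)
Lemma ex_subspace_codim b n d h : dim_ge X d -> (n <= b)%N -> (b <= d)%N ->
  exists Y : closedSubspace X, has_dim [set: quotient Y] b /\
    forall x, (Y : set X) x -> forall j, (j < n)%N -> h j x = 0.
Proof.
move=> Xd nb bd; have [m [e [g [mn eg gh]]]] := biorthogonal_annihilate n h.
have mb := leq_trans mn nb.
have := biorthogonal_extend (p := b - m) eg Xd; rewrite subnKC//.
move=> /(_ bd)[e' [g' [eg' E']]].
exists (common_kernel b g'); split; first exact: codim_common_kernel eg'.
move=> x Yx; apply: gh => i im; have [_ <-] := E' i im.
exact: Yx (leq_trans im mb).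
Qed.

(** After extension by [a] vectors, the new ones span [F]: biorthogonality makes the first [m]
    functionals vanish on them. *)
Lemma ex_subspace_dim a n h : dim_ge X (a + n) ->
  exists F : closedSubspace X, has_dim (F : set X) a /\
    forall x, (F : set X) x -> forall j, (j < n)%N -> h j x = 0.
Proof.
move=> Xan; have [m [e [g [mn eg gh]]]] := biorthogonal_annihilate n h.
have [|e' [g' [eg' E']]] := biorthogonal_extend (p := a) eg Xan.
  by rewrite addnC leq_add2l.
exists (biorthogonal_span a (fun i => e' (m + i)%N) (fun i => g' (m + i)%N)).
split.
  apply: dim_biorthogonal_span => i j ia ja.
  by rewrite eg' ?ltn_add2l// eqn_add2l.
move=> x /= ->; apply: gh => i im; rewrite linear_sum big1// => j _.
rewrite dualZ; have [_ <-] := E' i im; rewrite eg' ?ltn_add2l ?ltn_addr//.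
by rewrite ltn_eqF ?mulr0// ltn_addr.
Qed.

End Biorthogonal.

(** * Determinant bounds and the modulus [delta] *)

Lemma ler_norm_det (R : realDomainType) n (A : 'M[R]_n) (B : R) :
  (forall i j, `|A i j| <= B) -> `|\det A| <= n`!%:R * B ^+ n.
Proof.
move=> AB; rewrite (le_trans (ler_norm_sum _ _ _))//.
rewrite -card_Sn mulr_natl -sumr_const; apply: ler_sum => s _.
rewrite normrM normr_sign mul1r normr_prod -[in leRHS](card_ord n) -prodr_const.
by apply: ler_prod => i _; rewrite normr_ge0 AB.
Qed.

Section WeakRotundityFacts.
Variables (R : realType) (k : nat).

Lemma sum_norm_le (Z : normedModType R) (z : 'I_k.+1 -> Z) (c : R) :
  (forall i, `|z i| <= c) -> `|\sum_i z i| <= k.+1%:R * c.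
Proof.
move=> zc; rewrite (le_trans (ler_norm_sum _ _ _))//.
by rewrite mulr_natl -[X in _ *+ X](card_ord k.+1) -sumr_const ler_sum.
Qed.

Section Delta.
Variable Z : normedModType R.
Implicit Types (f : 'I_k -> dual Z) (z : 'I_k.+1 -> Z).

Let delta_lbound eps f : has_lbound ([set 1] `|`
  [set 1 - k.+1%:R^-1 * `|\sum_(i < k.+1) z i| | z in
     [set z : 'I_k.+1 -> Z | (forall i, `|z i| = 1) /\ eps <= `|Dk z f|]]).
Proof.
exists 0 => _ [->|[z [z1 _] <-]]; first exact: ler01.
rewrite subr_ge0 ler_pdivrMl ?ltr0Sn// mulr1.
by rewrite -[leRHS]mulr1 sum_norm_le// => i; rewrite z1.
Qed.

Lemma delta_ge eps f d : d <= 1 ->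
  (forall z, (forall i, `|z i| = 1) -> eps <= `|Dk z f| ->
    `|\sum_i z i| <= k.+1%:R * (1 - d)) ->
  d <= delta eps f.
Proof.
move=> d1 dz; apply: lb_le_inf; first by exists 1; left.
move=> _ [->//|[z [z1 zD] <-]].
by rewrite lerBrDl -lerBrDr ler_pdivrMl ?ltr0Sn// dz.
Qed.

Lemma delta_le1 eps f : delta eps f <= 1.
Proof. by apply: ge_inf => //; left. Qed.

Lemma delta_ge0 eps f : 0 <= delta eps f.
Proof.
apply: delta_ge => // z z1 _; rewrite subr0.
by apply: sum_norm_le => i; rewrite z1.
Qed.

Lemma delta_sum_le eps f z : (forall i, `|z i| = 1) -> eps <= `|Dk z f| ->
  `|\sum_i z i| <= k.+1%:R * (1 - delta eps f).
Proof.
move=> z1 zD; rewrite -ler_pdivrMl ?ltr0Sn// lerBrDl -lerBrDr.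
by apply: ge_inf => //; right; exists z.
Qed.

(* Rescaling column [i] by [t i] turns the first row of the matrix into [t];
   the change from [t] to the row of ones is linear in that row. *)
Lemma Dk_rescale f z (t : 'I_k.+1 -> R) (eta : R) :
  (forall j x, `|f j x| <= `|x|) -> (forall i, `|z i| <= 2) ->
  (forall i, t i != 0) -> (forall i, `|t i - 1| <= eta) ->
  `|Dk z f| <= (\prod_i `|t i|) * `|Dk (fun i => (t i)^-1 *: z i) f| +
    k.+1%:R * (k`!%:R * 2 ^+ k * eta).
Proof.
move=> f1 z2 t0 teta.
pose M (r : 'rV[R]_k.+1) : 'M[R]_k.+1 :=
  col_mx r (\matrix_(j < k, i < k.+1) f j (z i) : 'M[R]_(k, k.+1)).
have detE (r : 'rV[R]_k.+1) :
    \det (M r) = \sum_j r 0 j * cofactor (M (const_mx 1)) 0 j.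
  rewrite (expand_det_row _ (0 : 'I_k.+1)); apply: eq_bigr => j _.
  congr (_ * _).
    have -> : 0 = lshift k (0 : 'I_1) :> 'I_(1 + k) by apply: val_inj.
    exact: (@col_mxEu _ 1 k _ r _ 0 j).
  (* Minors along the first row do not see [r], so the determinant is linear in [r] with fixed
     cofactors. *)
  have minorE : row' 0 (col' j (M r)) = row' 0 (col' j (M (const_mx 1))).
    apply/matrixP => i l; rewrite !mxE.
    by case: splitP => // i0 /eqP; rewrite ord1 lift0.
  by rewrite /cofactor minorE.
have scaled : Dk (fun i => (t i)^-1 *: z i) f * \prod_i t i = \det (M (\row_i t i)).
  have -> : \prod_i t i = \det (diag_mx (\row_i t i)).
    by rewrite det_diag; apply: eq_bigr => i _; rewrite mxE.
  rewrite -det_mulmx; congr (\det _); apply/matrixP => i j.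
  rewrite mul_mx_diag !mxE; case: splitP => l _; rewrite !mxE ?mul1r//.
  by rewrite dualZ mulrAC mulVf// mul1r.
have -> : Dk z f = \prod_i t i * Dk (fun i => (t i)^-1 *: z i) f
    - (\det (M (\row_i t i)) - \det (M (const_mx 1))).
  by rewrite -scaled mulrC opprB addrCA subrr addr0.
rewrite (le_trans (ler_normB _ _))// normrM normr_prod lerD2l !detE -sumrB.
rewrite (le_trans (ler_norm_sum _ _ _))//.
rewrite mulr_natl -[X in _ *+ X](card_ord k.+1) -sumr_const; apply: ler_sum => j _.
rewrite !mxE -mulrBl normrM mulrC ler_pM// /cofactor normrM normr_sign mul1r.
(* The remaining entries are values [f j (z i)], of modulus at most 2; hence the factor
   [k! * 2 ^ k]. *)
apply: ler_norm_det => i l; rewrite !mxE.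
case: splitP => [i0 /eqP|i0 _]; first by rewrite ord1.
by rewrite mxE (le_trans (f1 _ _)).
Qed.

End Delta.

(** Normalising the [u i] costs little in [Dk] and at most [k.+1 * eta] in the sum. The constants
    precede [Z] and [f], so they serve [X] and all its quotients at once. *)
Lemma near_sphere_sum_le (eps : R) : 0 < eps ->
  exists eps' eta0 : R, [/\ 0 < eps', 0 < eta0 &
    forall (Z : normedModType R) (f : 'I_k -> dual Z) (u : 'I_k.+1 -> Z) (eta : R),
      (forall j, dual_sphere (f j)) -> eta <= eta0 ->
      (forall i, `| `|u i| - 1| <= eta) -> eps <= `|Dk u f| ->
      `|\sum_i u i| <= k.+1%:R * (1 - delta eps' f) + k.+1%:R * eta].
Proof.
move=> eps0; pose C : R := k.+1%:R * (k`!%:R * 2 ^+ k).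
have C0 : 0 < C by rewrite !mulr_gt0 ?exprn_gt0 ?ltr0n ?fact_gt0.
have P0 : 0 < (2 ^+ k.+1 : R) by rewrite exprn_gt0.
(* The bound [2^-1] keeps each norm between 1/2 and 2; [eps / 2 / C] limits the rescaling error to
   [eps / 2]. The other half is divided by [2 ^+ k.+1], which bounds the product of the norms. *)
exists (eps / 2 / 2 ^+ k.+1), (Num.min 2^-1 (eps / 2 / C)); split.
- by rewrite !divr_gt0.
- by rewrite lt_min invr_gt0 ltr0n !divr_gt0.
move=> Z f u eta f1; rewrite le_min ler_pdivlMr// => /andP[eta2 etaC] ueta uD.
have ubd i : 2^-1 <= `|u i| <= 2.
  by have := ueta i; rewrite ler_norml => /andP[]; lra.
have u0 i : `|u i| != 0 by have /andP[] := ubd i; lra.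
pose w i := `|u i|^-1 *: u i.
have w1 i : `|w i| = 1 by rewrite normrZ normfV normr_id mulVf.
have wD : eps / 2 / 2 ^+ k.+1 <= `|Dk w f|.
  rewrite ler_pdivrMr//.
  have := Dk_rescale (fun j x => dual_sphere_le x (f1 j))
    (fun i => (andP (ubd i)).2) u0 ueta.
  rewrite mulrA -/C => Dle.
  have : (\prod_i `| `|u i|%R|) * `|Dk w f| <= `|Dk w f| * 2 ^+ k.+1.
    rewrite mulrC ler_wpM2l// -[in leRHS](card_ord k.+1) -prodr_const.
    by apply: ler_prod => i _; rewrite normr_ge0 normr_id; case/andP: (ubd i).
  by move: Dle; rewrite -/w; lra.
have -> : \sum_i u i = \sum_i w i + \sum_i (`|u i| - 1) *: w i.
  rewrite -big_split; apply: eq_bigr => i _ /=.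
  by rewrite scalerBl scale1r addrC subrK scalerA divff// scale1r.
rewrite (le_trans (ler_normD _ _))// lerD ?delta_sum_le//.
by apply: sum_norm_le => i; rewrite normrZ w1 mulr1.
Qed.

(** * Comparison of a space with its quotients *)

Section Quotients.
Variable X : normedModType R.
Implicit Types (f : 'I_k -> dual X) (P : closedSubspace X -> Prop).

Lemma Dk_quotient f (M : closedSubspace X)
    (fM : forall j, (M : set X) `<=` [set x | f j x = 0]) (z : 'I_k.+1 -> X) :
  Dk (fun i => to_quotient M (z i)) (fun j => quotient_dual (fM j)) = Dk z f.
Proof.
congr (\det _); apply/matrixP => i j; rewrite !mxE.
by case: splitP => l _; rewrite !mxE ?quotient_dualE.
Qed.

(** Lifting to representatives keeps [Dk], and the quotient map does not increase the norm of their
    sum. Uniformity in [M] comes from [eps'] depending on [eps] and [k] alone. *)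
Lemma delta_quotient_ge (eps : R) : 0 < eps ->
  exists2 eps' : R, 0 < eps' & forall f (M : closedSubspace X)
    (fM : forall j, (M : set X) `<=` [set x | f j x = 0]),
    (forall j, dual_sphere (f j)) ->
    delta eps' f <= delta eps (fun j => quotient_dual (fM j)).
Proof.
move=> eps0; have [eps' [eta0 [eps'0 eta00 H]]] := near_sphere_sum_le eps0.
exists eps' => // f M fM f1; apply: delta_ge; first exact: delta_le1.
move=> z z1 zD; apply/ler_addgt0Pr => e e0.
(* The second term keeps the total error [k.+1 * eta] below [e]. *)
pose eta := Num.min eta0 (e / k.+1%:R).
have eta_gt0 : 0 < eta by rewrite lt_min eta00 divr_gt0.
have /choice[u uP] : forall i, exists x, to_quotient M x = z i /\ `|x| < 1 + eta.
  move=> i; have [|x xz xe] := @quotient_norm_lt _ _ M (z i) (1 + eta).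
    by rewrite -[quotient_norm _]/`|z i| z1 ltrDl.
  by exists x.
have uz i := (uP i).1.
have -> : \sum_i z i = to_quotient M (\sum_i u i).
  rewrite (big_morph _ (@to_quotientD _ _ M) (@to_quotient0 _ _ M)).
  by apply: eq_bigr => i _; rewrite uz.
apply: le_trans (quotient_norm_le _ _) _.
apply: (le_trans (H X f u eta f1 _ _ _)).
- by rewrite ge_min lexx.
- move=> i; have := quotient_norm_le M (u i).
  rewrite uz -[quotient_norm _]/`|z i| z1 => u1.
  by rewrite ger0_norm ?subr_ge0// lerBlDl ltW// (uP i).2.
- rewrite -(Dk_quotient fM); apply: le_trans zD _.
  by rewrite (_ : z = fun i => to_quotient M (u i))//; apply/funext => i.
by rewrite lerD2l mulrC -ler_pdivlMr// ge_min lexx orbT.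
Qed.

(** The witness [M] makes the family nonempty: [inf] of the empty set is 0 by default. *)
Lemma inf_delta_quotient_ge P eps f (M : closedSubspace X) d : P M ->
  (forall j, (M : set X) `<=` [set x | f j x = 0]) ->
  (forall (N : closedSubspace X) (fN : forall j, (N : set X) `<=` [set x | f j x = 0]),
    P N -> d <= delta eps (fun j => quotient_dual (fN j))) ->
  d <= inf_delta_quotient P eps f.
Proof.
move=> PM fM dP; apply: lb_le_inf.
  by exists (delta eps (fun j => quotient_dual (fM j))), M, fM.
by move=> _ [N [fN [PN ->]]]; exact: dP.
Qed.

Lemma inf_delta_quotient_le P eps f (M : closedSubspace X)
    (fM : forall j, (M : set X) `<=` [set x | f j x = 0]) : P M ->
  inf_delta_quotient P eps f <= delta eps (fun j => quotient_dual (fM j)).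
Proof.
move=> PM; apply: ge_inf; last by exists M, fM.
by exists 0 => _ [N [fN [_ ->]]]; exact: delta_ge0.
Qed.

Definition quotient_kWUR P : Prop :=
  forall (eps : R) f, 0 < eps -> (forall j, dual_sphere (f j)) ->
    0 < inf_delta_quotient P eps f.

(** The extra [g] leaves room for a functional norming a sum; the property also makes the infimum
    range over a nonempty family. *)
Definition kernels_contain P : Prop := forall f (g : dual X),
  exists2 M, P M & (forall j, (M : set X) `<=` [set x | f j x = 0]) /\
    (M : set X) `<=` [set x | g x = 0].

Lemma kWUR_quotient : kernels_contain (fun=> True) -> kWUR k X ->
  quotient_kWUR (fun=> True).
Proof.
move=> av WUR eps f eps0 f1.
have [eps' eps'0 le_delta] := delta_quotient_ge eps0.
(* Here [g] is arbitrary: only some admissible [M] is sought. *)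
have [g _] := norming_dual (0 : X); have [M _ [fM _]] := av f g.
apply: (@lt_le_trans _ _ (delta eps' f)); first exact: WUR.
by apply: (inf_delta_quotient_ge (M := M)) => // N fN _; exact: le_delta.
Qed.

Lemma quotient_kWUR_sub P : kernels_contain P ->
  quotient_kWUR (fun=> True) -> quotient_kWUR P.
Proof.
move=> av WUR eps f eps0 f1.
have [g _] := norming_dual (0 : X); have [M PM [fM _]] := av f g.
apply: lt_le_trans (WUR eps f eps0 f1) _.
apply: (inf_delta_quotient_ge (M := M)) => // N fN _.
exact: inf_delta_quotient_le.
Qed.

(* Passing to a quotient by a subspace of [ker g], with [g] norming the sum
   of the [z i], preserves the norm of that sum. *)
Lemma quotient_kWUR_kWUR P : kernels_contain P -> quotient_kWUR P -> kWUR k X.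
Proof.
move=> av WUR eps f eps0 f1.
have [eps' [eta0 [eps'0 eta00 H]]] := near_sphere_sum_le eps0.
pose d := inf_delta_quotient P eps' f.
have d0 : 0 < d by exact: WUR.
have K0 : 0 < k.+1%:R :> R by rewrite ltr0n.
have d1 : d <= 1.
  have [g _] := norming_dual (0 : X); have [M PM [fM _]] := av f g.
  exact: le_trans (inf_delta_quotient_le eps' fM PM) (delta_le1 _ _).
(* With [K = k.+1], the first term settles the case [K - S > eta0]. Otherwise
   [S <= K * (1 - d) + K * (K - S)], that is [(1 + K) * S <= K * (1 + K - d)], and the second term
   suffices. *)
pose c := Num.min (eta0 / k.+1%:R) (d / (1 + k.+1%:R)).
have K1 : 0 < 1 + k.+1%:R :> R by rewrite addr_gt0.
apply: (@lt_le_trans _ _ c); first by rewrite lt_min !divr_gt0.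
apply: delta_ge.
  rewrite ge_min; apply/orP; right; rewrite ler_pdivrMr// mul1r; lra.
move=> z z1 zD; set S := `|_|.
have [g [g1 gS]] := norming_dual (\sum_i z i).
have [M PM [fM gM]] := av f g.
pose u i := to_quotient M (z i).
(* As [g] vanishes on [M], it is constant on cosets, so every representative bounds it. *)
have g_le x : `|g x| <= `|to_quotient M x|.
  apply: lb_le_inf; first by exists `|x|, x.
  move=> _ [y /to_quotientP/gM/= + <-]; rewrite linearB/= => /eqP.
  by rewrite subr_eq0 => /eqP <-.
have SE : \sum_i u i = to_quotient M (\sum_i z i).
  by rewrite (big_morph _ (@to_quotientD _ _ M) (@to_quotient0 _ _ M)).
have S_le : S <= `|\sum_i u i|.
  by rewrite SE (le_trans _ (g_le _))// gS normr_id.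
pose eta := k.+1%:R - S.
have u_le i : `|u i| <= 1 by rewrite -(z1 i); exact: quotient_norm_le.
(* The other [k] norms are at most 1, so a sum of norm near [k.+1] leaves almost 1 for the
   [i]-th. *)
have u_ge i : 1 - eta <= `|u i|.
  have : \sum_(j | j != i) `|u j| <= k%:R.
    rewrite (le_trans (ler_sum _ (fun j _ => u_le j)))//.
    rewrite sumr_const cardC1 card_ord lexx//.
  have : S <= `|u i| + \sum_(j | j != i) `|u j|.
    rewrite (le_trans S_le)// (le_trans (ler_norm_sum _ _ _))//.
    by rewrite (bigD1 i).
  rewrite /eta -natr1; lra.
have [eta_le|eta_gt] := leP eta eta0; last first.
  have c_le : c * k.+1%:R <= eta0.
    by rewrite -ler_pdivlMr// ge_min lexx.
  by move: eta_gt; rewrite /eta; lra.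
have Su : `|\sum_i u i| <=
    k.+1%:R * (1 - delta eps' (fun j => quotient_dual (fM j))) + k.+1%:R * eta.
  apply: H => // [j|i|]; last by rewrite Dk_quotient.
    by rewrite /dual_sphere/= quotient_dual_norm; exact: f1.
  by rewrite ler0_norm ?subr_le0// opprB; have := u_ge i; lra.
have := inf_delta_quotient_le eps' fM PM; rewrite -/d; set D := delta _ _ => dD.
have cd : c * (1 + k.+1%:R) <= d by rewrite -ler_pdivlMr// ge_min lexx orbT.
have := ler_wpM2l (ltW K0) dD; have := ler_wpM2l (ltW K0) cd.
move: S_le Su; rewrite /eta; set K : R := k.+1%:R in K0 K1 *.
move=> h1 h2 h3 h4.
have h5 : (1 + K) * S <= (1 + K) * (K * (1 - c)) by nra.
by rewrite -(ler_pM2l K1).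
Qed.

End Quotients.
End WeakRotundityFacts.

(** * Subspaces of prescribed size and the equivalence *)

Section KernelSubspaces.
Variables (R : realType) (X : normedModType R) (k : nat).

Lemma dual_family_cons (f : 'I_k -> dual X) (g : dual X) :
  exists h : nat -> dual X, h k = g /\ forall j : 'I_k, h j = f j.
Proof.
exists (fun j => if insub j is Some i then f i else g); split=> [|j].
  by rewrite insubN// ltnn.
by rewrite valK.
Qed.

Lemma kernels_contain_codim b d : dim_ge X d -> (k < b)%N -> (b <= d)%N ->
  kernels_contain k (fun Y : closedSubspace X => has_dim [set: quotient Y] b).
Proof.
move=> Xd kb bd f g; have [h [hg hf]] := dual_family_cons f g.
(* The functional [g] sits at index [k] of [h], so [k.+1] functionals are annihilated, which is why
   [k < b]. *)
have [Y [Yb Yh]] := ex_subspace_codim h Xd kb bd; exists Y => //; split=> [j|] x Yx /=.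
  by rewrite -hf Yh// ltnS ltnW.
by rewrite -hg Yh.
Qed.

Lemma kernels_contain_dim a : dim_ge X (a + k.+1) ->
  kernels_contain k (fun F : closedSubspace X => has_dim (F : set X) a).
Proof.
move=> Xa f g; have [h [hg hf]] := dual_family_cons f g.
have [F [Fa Fh]] := ex_subspace_dim h Xa; exists F => //; split=> [j|] x Fx /=.
  by rewrite -hf Fh// ltnS ltnW.
by rewrite -hg Fh.
Qed.

End KernelSubspaces.

Theorem theorem4p1 (R : realType) (X : completeNormedModType R)
    (k alpha beta : nat) (k_gt0 : (0 < k)%N)
    (alpha_gt0 : (0 < alpha)%N) (beta_gt0 : (0 < beta)%N)
    (dimX : dim_ge X (k + 2))
    (alpha_le : dim_ge X (alpha + (k + 1)))
    (beta_ge : (k + 1 <= beta)%N) (beta_le : dim_ge X (beta + 1)) :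
  [<-> kWUR k X ;
       forall (eps : R) (f : 'I_k -> dual X), 0 < eps ->
         (forall j, dual_sphere (f j)) ->
         0 < inf_delta_quotient (fun _ => True) eps f ;
       forall (eps : R) (f : 'I_k -> dual X), 0 < eps ->
         (forall j, dual_sphere (f j)) ->
         0 < inf_delta_quotient (fun F => has_dim (F : set X) alpha) eps f ;
       forall (eps : R) (f : 'I_k -> dual X), 0 < eps ->
         (forall j, dual_sphere (f j)) ->
         0 < inf_delta_quotient
               (fun Y => has_dim [set: quotient Y] beta) eps f ].
Proof.
rewrite !addn1 in alpha_le beta_ge beta_le.
have dimF := kernels_contain_dim alpha_le.
have codimY := kernels_contain_codim beta_le beta_ge (leqnSn beta).
have all_kernels : kernels_contain k (fun _ : closedSubspace X => True).
  by move=> f g; have [M _ fgM] := dimF f g; exists M.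
tfae.
- exact: kWUR_quotient.
- exact: quotient_kWUR_sub.
(* From (3) to (4) the path goes through (1) and (2). *)
- move=> WURF; apply: (quotient_kWUR_sub codimY).
  apply: (kWUR_quotient all_kernels).
  exact: quotient_kWUR_kWUR WURF.
- exact: quotient_kWUR_kWUR.
Qed.
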